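(* Let $X_1\subset X_2\subset X_3$ be Banach spaces (each a linear subspace of the next), with norms $\|\cdot\|_1,\|\cdot\|_2,\|\cdot\|_3$ respectively. Assume: (i) (the norms are comparable) $\|u\|_1\ge \|u\|_2$ for all $u\in X_1$, and $\|u\|_2\ge\|u\|_3$ for all $u\in X_2$; (ii) (the norms in $X_2$ and $X_3$ are compatible) if $(u_n)$ is a sequence in $X_2$ which is fundamental in $X_2$ and $\|u_n\|_3\to 0$ as $n\to\infty$, then $\|u_n\|_2\to 0$ as $n\to\infty$. Then the embedding operator $i:X_1\to X_2$ is compact if and only if the following two conditions both hold: a) the embedding operator $j:X_1\to X_3$ is compact; b) for every $s\in(0,1)$ there is a constant $c(s)>0$ such that $$\|u\|_2\le s\|u\|_1+c(s)\|u\|_3\qquad\text{for all } u\in X_1.$$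
   Context: The Banach spaces are over the same scalar field ($\mathbb{R}$ or $\mathbb{C}$), and each is complete in its own norm. The embedding operators are the inclusion maps $i(u)=u$, $i:X_1\to X_2$, and $j(u)=u$, $j:X_1\to X_3$. ''Fundamental in $X_2$'' means Cauchy with respect to $\|\cdot\|_2$. The constant $c(s)$ may depend on $s$ but not on $u$. *)

(* Defs.v *)
From HB Require Import structures.
From mathcomp Require Import all_boot all_order all_algebra.
From mathcomp Require Import all_classical all_reals all_analysis.
From mathcomp Require Import complex.

Set Implicit Arguments.
Unset Strict Implicit.
Unset Printing Implicit Defensive.

Import Order.TTheory GRing.Theory Num.Theory.
Import numFieldNormedType.Exports.

Local Open Scope classical_set_scope.
Local Open Scope ring_scope.

Variant scalar_kind := RealScalars | ComplexScalars.

(* Norms take their values in the scalar field itself.  On [R[i]] the order is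
   the partial one for which [x <= y] forces [x] and [y] to have the same
   imaginary part, so [0 <= x] says that [x] is a nonnegative real and
   [0 < s < 1] that [s] is a real number strictly between 0 and 1. *)
Definition scalar_field (R : realType) (k : scalar_kind) : numFieldType :=
  match k with
  | RealScalars => R
  | ComplexScalars => R[i]
  end.

(* [precompact A] is compactness of [closure A], see [precompactE]. *)
Definition compact_operator (K : numFieldType) (V W : normedModType K)
    (f : {linear V -> W}) : Prop :=
  forall A : set V, bounded_set A -> precompact (f @` A).

(* Main.v *)
(* Write v = i u.  If [i] is compact, the closure C of the image of the unit
   ball of X1 is compact and is covered by the increasing family of sets
   [`|v| < s + c * `|e v|], because [e v = 0] only for [v = 0]; so a single c
   works on all of C, and b) follows by homogeneity.  Conversely, b) applied to
   differences shows that on the image of a bounded set Cauchy for the norm of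
   X3 implies Cauchy for the norm of X2, since s can be taken arbitrarily small;
   hence every ultrafilter on the closure of that image converges in X2. *)
Require Import Defs.
From HB Require Import structures.
From mathcomp Require Import all_boot all_order all_algebra.
From mathcomp Require Import all_classical all_reals all_analysis.
From mathcomp Require Import ring.

Set Implicit Arguments.
Unset Strict Implicit.
Unset Printing Implicit Defensive.

Import Order.TTheory GRing.Theory Num.Theory.
Import numFieldNormedType.Exports.

Local Open Scope classical_set_scope.
Local Open Scope ring_scope.

Section Ehrling.
Variable K : numFieldType.

Lemma near_norm_lt (V : normedModType K) (x : V) (d : K) :
  0 < d -> \forall y \near x, `|x - y| < d.
Proof. by move=> d0; exact: (nbhs_ball_norm x (PosNum d0)). Qed.

Lemma contraction_continuous (V W : normedModType K) (f : {linear V -> W}) :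
  (forall u, `|f u| <= `|u|) -> continuous f.
Proof.
move=> f1 x; apply/cvgrPdist_lt => eps eps0.
near=> y; rewrite -linearB (le_lt_trans (f1 _))//.
Unshelve. all: by end_near. Qed.

(** A continuous [g] sends the compact closure of the image of [A] under [f] to a compact set, which
    contains the image of [A] under [g \o f]. *)
Lemma compact_operator_comp (V W Z : normedModType K)
    (f : {linear V -> W}) (g : {linear W -> Z}) :
  compact_operator f -> continuous g -> compact_operator (g \o f).
Proof.
move=> fC gC A /fC; rewrite precompactE => cA.
have cgA : compact (g @` closure (f @` A)).
  by apply: continuous_compact => //; exact: continuous_subspaceT.
apply: (precompact_subset _ (compact_precompact (@norm_hausdorff _ _) cgA)).
move=> _ [u Au <-]; exists (f u) => //.
by apply: subset_closure; exists u.
Qed.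

Lemma ehrling (V W Z : normedModType K) (f : {linear V -> W})
    (g : {linear W -> Z}) :
  compact_operator f -> continuous g -> injective g ->
  forall s : K, 0 < s ->
    exists2 c, 0 < c & forall u, `|f u| <= s * `|u| + c * `|g (f u)|.
Proof.
move=> fC gC g_inj s s0.
have : bounded_set [set u : V | `|u| <= 1].
  by exists 1; split=> // M M1 u /= u1; exact: le_trans u1 (ltW M1).
move=> /fC; rewrite precompactE => /compact_near_coveringP.
(* Compactness as near-covering: if the bound holds for all [x] near each [v] of the closure and all
   large [c], then one [c] serves the whole closure. *)
move=> /(_ _ (pinfty_nbhs K) (fun c x => `|x| < s + c * `|g x|) _).
case/(_ _)/pinfty_ex_gt0 => [v _|c c0 cP]; last first.
  exists c => // u; have [->|u0] := eqVneq u 0.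
    by rewrite !linear0 !normr0 !mulr0 addr0.
  have nu0 : 0 < `|u| by rewrite normr_gt0.
  have /cP /= : closure (f @` [set u : V | `|u| <= 1]) (f (`|u|^-1 *: u)).
    apply: subset_closure; exists (`|u|^-1 *: u) => //=.
    by rewrite normrZ normfV normr_id mulVf ?gt_eqF.
  rewrite linearZ/= linearZ/= !normrZ normfV normr_id -(ltr_pM2l nu0) mulrDr.
  by rewrite [_ * s]mulrC [c * (_ * _)]mulrCA !mulVKf ?gt_eqF// => /ltW.
(* For [v = 0] the quotient is [0 / 0 = 0], so the norm of [v] is [a] times that of [g v] in all
   cases. *)
pose a := `|v| / `|g v|.
have a0 : 0 <= a by rewrite divr_ge0.
have va : `|v| = a * `|g v|.
  have [v0|v0] := eqVneq v 0; first by rewrite /a v0 normr0 !mul0r.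
  rewrite divfK// normr_eq0; apply: contra_neq v0 => gv.
  by apply: g_inj; rewrite gv linear0.
have a1 : 0 < 1 + a by rewrite ltr_pwDl.
(* The budget [s = d + a * d] pays [d] for replacing [v] by [x] and [a * d] for replacing [g v] by
   [g x]. *)
pose d := s / (1 + a).
have d0 : 0 < d by rewrite divr_gt0.
have sE : s = d + a * d by rewrite -[X in X + _]mul1r -mulrDl mulrC divfK ?gt_eqF.
near=> x c => /=.
have xv : `|v - x| < d.
  by near: x; exact: near_norm_lt.
have gxv : `|g v - g x| < d by near: x; exact: (gC v _ (near_norm_lt (g v) d0)).
have ac : a <= c by near: c; apply: nbhs_pinfty_ge; exact: ger0_real.
have gv : `|g v| <= `|g x| + d.
  by rewrite -(subrK (g x) (g v)) addrC (le_trans (ler_normD _ _))// lerD2l ltW.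
have : `|x| < `|v| + d.
  rewrite -(subrK v x) addrC (le_lt_trans (ler_normD _ _))// ltrD2l.
  by rewrite distrC.
move=> /lt_le_trans; apply; rewrite va sE addrC -addrA lerD2l addrC.
rewrite (le_trans (ler_wpM2l a0 gv))// mulrDr lerD2r.
by rewrite ler_wpM2r.
Unshelve. all: by end_near. Qed.

Lemma compact_operator_ehrling (V Z : normedModType K)
    (W : completeNormedModType K) (f : {linear V -> W}) (g : {linear W -> Z}) :
  continuous g -> compact_operator (g \o f) ->
  (forall s : K, 0 < s < 1 ->
    exists2 c, 0 < c & forall u, `|f u| <= s * `|u| + c * `|g (f u)|) ->
  compact_operator f.
Proof.
move=> gC gfC fs A bA.
have [M M0 AM] : exists2 M : K, 0 < M & forall u, A u -> `|u| <= M.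
  exact: pinfty_ex_gt0 bA.
rewrite precompactE compact_ultra => F FU FA.
have FgA : F (g @^-1` closure ((g \o f) @` A)).
  apply: filterS FA => x xA B gB.
  have [_ [[u Au <-] Bu]] := xA _ (gC x B gB).
  by exists (g (f u)); split=> //; exists u.
have := gfC A bA; rewrite precompactE => /(_ (g @ F) _ FgA)[z [_ zF]].
(* An ultrafilter contains each set or its complement, so the cluster point [z] is a limit of
   [g @ F]. *)
have gFz d : 0 < d -> F [set x | `|z - g x| < d].
  move=> d0; have [//|FN] := in_ultra_setVsetC [set x | `|z - g x| < d] FU.
  by have [w []] := zF [set w | ~ `|z - w| < d] _ FN (near_norm_lt z d0).
have FC : cauchy F.
  apply/cauchy_ballP => eps eps0.
  have M4 : 0 < eps + 4 * M by rewrite addr_gt0// mulr_gt0.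
  (* This [s] satisfies [s * (M + M) <= eps / 2]; the summand [eps] in the denominator keeps it
     below 1. *)
  have [|c c0 fc] := fs (eps / (eps + 4 * M)).
    by rewrite divr_gt0//= ltr_pdivrMr// mul1r ltrDl mulr_gt0.
  (* Solves [2 * d + 4 * c * d = eps / 2], the half of [eps] left over by the term in [s]. *)
  pose d := eps / (2 * (2 + 4 * c)).
  have c4 : 0 < 2 + 4 * c by rewrite addr_gt0// mulr_gt0.
  have d0 : 0 < d by rewrite divr_gt0// mulr_gt0.
  (* The inequality is given only on the range of [f], so a point of the closure is first moved to a
     nearby [f u]; continuity of [g] keeps [g (f u)] near [z]. *)
  have approx x : closure (f @` A) x -> `|z - g x| < d ->
      exists u, [/\ A u, `|x - f u| < d & `|z - g (f u)| < d + d].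
    move=> xA zx.
    have : nbhs x [set y | `|x - y| < d /\ `|g x - g y| < d].
      apply: filterI.
        exact: near_norm_lt.
      exact: (gC x _ (near_norm_lt (g x) d0)).
    move=> /xA[_ [[u Au <-] [xu gxu]]]; exists u; split=> //.
    by rewrite -(subrK (g x) z) -addrA (le_lt_trans (ler_normD _ _))// ltrD.
  near=> x y.
  have [u [Au xu zu]] : exists u,
      [/\ A u, `|x - f u| < d & `|z - g (f u)| < d + d].
    by apply: approx; near: x; [exact: FA|exact: gFz].
  have [v [Av yv zv]] : exists v,
      [/\ A v, `|y - f v| < d & `|z - g (f v)| < d + d].
    by apply: approx; near: y; [exact: FA|exact: gFz].
  rewrite -ball_normE /=.
  have uvM : `|u - v| <= M + M by rewrite (le_trans (ler_normB _ _))// lerD ?AM.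
  have guv : `|g (f (u - v))| < d + d + (d + d).
    rewrite !linearB -(subrK z (g (f u))) -addrA (le_lt_trans (ler_normD _ _))//.
    by rewrite ltrD// distrC.
  have -> : x - y = (x - f u) + f (u - v) + (f v - y).
    by rewrite linearB/= !subrKA.
  have sM : eps / (eps + 4 * M) * `|u - v| <= eps / 2.
    have s0 : 0 <= eps / (eps + 4 * M) by rewrite divr_ge0// ltW.
    rewrite (le_trans (ler_wpM2l s0 uvM))// mulrAC ler_pdivrMr//.
    have -> : eps / 2 * (eps + 4 * M) = eps * (M + M) + eps * eps / 2 by field.
    by rewrite lerDl divr_ge0// mulr_ge0// ltW.
  have dE : eps / 2 = d + d + c * (d + d + (d + d)).
    by rewrite /d; field; rewrite gt_eqF.
  have fuv : `|f (u - v)| < eps / 2 + c * (d + d + (d + d)).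
    by rewrite (le_lt_trans (fc _))// ler_ltD// ltr_pM2l.
  have -> : eps = d + (eps / 2 + c * (d + d + (d + d))) + d.
    by rewrite {1}[eps]splitr {2}dE; ring.
  rewrite (le_lt_trans (ler_normD _ _))// ltrD//; last by rewrite distrC.
  by rewrite (le_lt_trans (ler_normD _ _))// ltrD.
have Fl : cvg F by exact: cauchy_cvg.
exists (lim F); split=> //.
by apply: (@closed_cvg _ _ F _ id _ _ FA _ Fl); exact: closed_closure.
Unshelve. all: by end_near. Qed.

End Ehrling.

(* The inclusions X1 c X2 c X3 are the injective linear maps i and e; the
   inclusion j of X1 into X3 is their composite. *)
Theorem theorem1 (R : realType) (k : scalar_kind)
    (X1 X2 X3 : completeNormedModType (scalar_field R k))
    (i : {linear X1 -> X2}) (e : {linear X2 -> X3})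
    (i_inj : injective i) (e_inj : injective e)
    (norm12 : forall u : X1, `|i u| <= `|u|)
    (norm23 : forall u : X2, `|e u| <= `|u|)
    (compat : forall u : nat -> X2, cauchy (u @ \oo) ->
       `|e (u n)| @[n --> \oo] --> (0 : scalar_field R k) ->
       `|u n| @[n --> \oo] --> (0 : scalar_field R k)) :
  compact_operator i <->
  compact_operator (e \o i) /\
  (forall s : scalar_field R k, 0 < s < 1 ->
     exists2 c : scalar_field R k, 0 < c &
       forall u : X1, `|i u| <= s * `|u| + c * `|e (i u)|).
Proof.
have eC := contraction_continuous norm23.
split=> [iC|[jC]]; last exact: compact_operator_ehrling.
split; first exact: compact_operator_comp.
by move=> s /andP[s0 _]; exact: ehrling.
Qed.
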